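(* Let $u=u(\alpha,\delta,m)$ be the upper bound on the required number of samples defined in the context. For the sampling-and-optimization algorithm with uniform sampling, the number of samples taken, the number of optimizer calls, and the number of iterations are all in $O(u(\alpha,\delta,m))$. That is, there is a constant $K$, depending only on the number $k$ of samples per iteration and the bound $b$ on optimizer calls per iteration, such that for all $m\ge1$, $\alpha>1$, $\delta\in[0,1)$ each of these three quantities is at most $K\cdot u(\alpha,\delta,m)$.
   Context: Setting: a query with $m\ge1$ predicates of unknown selectivity, an approximation factor $\alpha>1$ and a confidence threshold $\delta\in[0,1)$. All predicates have the same selectivity mean $a\in(0,1]$, which stays fixed over the iterations. With $d=a(1-\alpha^{-1/(2m)})$, define $$u(\alpha,\delta,m)=\frac{m\log\bigl(2/(1-\sqrt[m]{\delta})\bigr)}{2d^2}$$ ($\log$ natural). This is the number of samples sufficient to reach confidence $\delta$ that the plan optimal at the current means has cost within factor $\alpha$ of optimal. The algorithm proceeds in iterations. In each iteration it makes at least one and at most $b$ calls to a standard query optimizer, where $b$ is a fixed constant, and then takes a batch of samples distributed uniformly over the predicates. It terminates at the latest at the end of the first iteration after which the total number of samples taken is at least $u(\alpha,\delta,m)$. (Samples taken for initialization are disregarded.) Uniform sampling: the same fixed number $k\ge1$ of samples is taken in each iteration, so after $n$ iterations $nk$ samples have been taken in total. *)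

(* Defs.v *)
From HB Require Import structures.
From mathcomp Require Import all_boot all_order all_algebra.
From mathcomp Require Import reals exp.

Set Implicit Arguments.
Unset Strict Implicit.
Unset Printing Implicit Defensive.

Import Order.TTheory GRing.Theory Num.Theory.
Local Open Scope ring_scope.

(* d = a (1 - alpha^(-1/(2m))) *)
Definition sel_dist (R : realType) (a alpha : R) (m : nat) : R :=
  a * (1 - alpha `^ (- ((2 * m)%N%:R)^-1)).

(* The sample bound u(alpha, delta, m) at the common selectivity mean [a].
   The m-th root is written with [powR], for which 0 `^ (1/m) = 0 when
   0 < m, so the formula is also the intended one at delta = 0. *)
Definition sample_bound (R : realType) (a alpha delta : R) (m : nat) : R :=
  m%:R * ln (2 / (1 - delta `^ (m%:R^-1))) / (2 * sel_dist a alpha m ^+ 2).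

(* [batch i] is the number of samples taken for predicate i. *)
Record iteration (m : nat) := Iteration {
  calls : nat;
  batch : 'I_m -> nat
}.

Definition batch_size (m : nat) (it : iteration m) : nat :=
  (\sum_(i < m) batch it i)%N.

(* The number of samples need not be a multiple of m, so "distributed uniformly
   over the predicates" means as evenly as integrality permits: the shares of
   two predicates differ by at most one. *)
Definition evenly_distributed (m : nat) (it : iteration m) : bool :=
  [forall i, forall j, (batch it i <= (batch it j).+1)%N].

(* A terminated run is the list of its iterations in chronological order. *)
Definition run (m : nat) := seq (iteration m).

Definition num_iterations (m : nat) (r : run m) : nat := size r.

Definition num_calls (m : nat) (r : run m) : nat := (\sum_(it <- r) calls it)%N.

Definition num_samples (m : nat) (r : run m) : nat :=
  (\sum_(it <- r) batch_size it)%N.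

(* The run may stop earlier than [run_stops] requires: which of the admissible
   runs occurs depends on the sample outcomes. *)
Record algorithm_run (R : realType) (u : R) (b m : nat) (r : run m) : Prop :=
  AlgorithmRun {
    run_calls : all (fun it => (1 <= calls it <= b)%N) r;
    run_even : all (@evenly_distributed m) r;
    run_stops : forall n : nat, (1 <= n <= size r)%N ->
      u <= (num_samples (take n r))%:R -> size r = n
  }.

Definition uniform_sampling (k m : nat) (r : run m) : bool :=
  all (fun it => batch_size it == k) r.

(* Main.v *)
(* A run of n >= 2 iterations had fewer than u samples after n - 1 of them, so
   n k < u + k. Since the logarithm is at least ln 2 and 0 < d < 1, the bound u
   is at least ln 2 / 2, which absorbs the additive k. *)
Require Import Defs.
From HB Require Import structures.
From mathcomp Require Import all_boot all_order all_algebra.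
From mathcomp Require Import reals exp.

Set Implicit Arguments.
Unset Strict Implicit.
Unset Printing Implicit Defensive.

Import Order.TTheory GRing.Theory Num.Theory.
Local Open Scope ring_scope.

Lemma sel_dist_itv (R : realType) (a alpha : R) (m : nat) :
  (1 <= m)%N -> 0 < a <= 1 -> 1 < alpha -> 0 < sel_dist a alpha m < 1.
Proof.
move=> m1 /andP[a0 a1] alpha1; rewrite /sel_dist.
have alpha0 : 0 < alpha by exact: lt_trans alpha1.
have p0 : 0 < alpha `^ (- ((2 * m)%N%:R)^-1) by rewrite powR_gt0.
have p1 : alpha `^ (- ((2 * m)%N%:R)^-1) < 1.
  (* Inverting reduces the claim to [1 < alpha] raised to a positive exponent, which is strict
     monotonicity of the power compared with its value at base 1. *)
  rewrite powRN invf_lt1 ?powR_gt0//.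
  have e0 : 0 < (2 * m)%N%:R^-1 :> R by rewrite invr_gt0 ltr0n muln_gt0.
  have := gt0_ltr_powR e0 _ _ alpha1; rewrite powR1; apply.
    by rewrite nnegrE ler01.
  by rewrite nnegrE ltW.
rewrite mulr_gt0 ?subr_gt0//=.
rewrite (@le_lt_trans _ _ (1 - alpha `^ (- ((2 * m)%N%:R)^-1)))//.
  by rewrite ler_piMl// subr_ge0 ltW.
by rewrite gtrBl.
Qed.

Lemma sample_bound_ge (R : realType) (a alpha delta : R) (m : nat) :
  (1 <= m)%N -> 0 < a <= 1 -> 1 < alpha -> 0 <= delta < 1 ->
  ln 2 / 2 <= sample_bound a alpha delta m.
Proof.
move=> m1 ha halpha /andP[delta0 delta1]; rewrite /sample_bound.
have /andP[d0 d1] := sel_dist_itv m1 ha halpha.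
move: (sel_dist _ _ _) d0 d1 => d d0 d1.
have ln2_ge0 : 0 <= ln 2 :> R by rewrite ln_ge0// ler1n.
have q1 : delta `^ (m%:R^-1) < 1.
  have e0 : 0 < m%:R^-1 :> R by rewrite invr_gt0 ltr0n.
  have := gt0_ltr_powR e0 _ _ delta1; rewrite powR1; apply => //.
  by rewrite nnegrE ler01.
have q0 : 0 <= delta `^ (m%:R^-1) by exact: powR_ge0.
set q := _ `^ _ in q0 q1 *.
(* As [0 <= q < 1], the denominator lies in (0, 1], so the quotient is at least 2. *)
have lnq : ln 2 <= ln (2 / (1 - q)).
  rewrite ler_ln ?posrE ?divr_gt0 ?subr_gt0// ler_pdivlMr ?subr_gt0//.
  by rewrite ler_piMr ?gerBl.
(* Numerator and inverse denominator are compared separately: [m >= 1] handles the first, [d < 1]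
   the second. *)
apply: ler_pM => //; first by rewrite invr_ge0.
  by rewrite -[leLHS]mul1r ler_pM// ler1n.
rewrite lef_pV2 ?posrE ?mulr_gt0 ?exprn_gt0//.
by rewrite ler_piMr// expr_le1// ltW.
Qed.

Lemma num_samples_uniform (k m : nat) (r : run m) :
  uniform_sampling k r -> num_samples r = (size r * k)%N.
Proof.
rewrite /num_samples; elim: r => [|it r IHr] /=; first by rewrite big_nil.
by case/andP=> /eqP kE /IHr rE; rewrite big_cons rE kE mulSn.
Qed.

Lemma num_calls_le (b m : nat) (r : run m) :
  all (fun it => (1 <= calls it <= b)%N) r -> (num_calls r <= size r * b)%N.
Proof.
rewrite /num_calls; elim: r => [|it r IHr] /=; first by rewrite big_nil.
by case/andP=> /andP[_ itb] /IHr rb; rewrite big_cons mulSn leq_add.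
Qed.

Lemma uniform_run_size_le (R : realType) (u : R) (b k m : nat) (r : run m) :
  0 <= u -> algorithm_run u b r -> uniform_sampling k r ->
  (size r * k)%:R <= u + k%:R.
Proof.
move=> u0 [_ _ stops] unif.
(* With at most one iteration there are at most [k] samples. Only a longer run has a nonempty proper
   prefix to which the stopping rule can apply. *)
case sr : (size r) => [|[|n]].
- by rewrite mul0n addr_ge0.
- by rewrite mul1n lerDr.
have {stops} := stops n.+1; rewrite sr leqnSn => /(_ isT).
have takeE : num_samples (take n.+1 r) = (n.+1 * k)%N.
  rewrite (@num_samples_uniform k) ?size_take ?sr ?ltnSn//.
  by move: unif; rewrite -{1}(cat_take_drop n.+1 r) /uniform_sampling all_cat => /andP[].
(* Had the prefix without the last iteration reached [u], the stopping rule would give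
   [n.+2 = n.+1]. *)
rewrite takeE (mulSnr n.+1) natrD lerD2r; case: ltP => [/ltW//|_ /(_ isT) /eqP].
by rewrite eqn_leq ltnn.
Qed.

Theorem theorem3 (R : realType) (k b : nat) (hk : (1 <= k)%N) :
  exists K : R,
    forall (m : nat) (a alpha delta : R) (r : run m),
      (1 <= m)%N -> 0 < a <= 1 -> 1 < alpha -> 0 <= delta < 1 ->
      algorithm_run (sample_bound a alpha delta m) b r ->
      uniform_sampling k r ->
      [/\ (num_samples r)%:R <= K * sample_bound a alpha delta m,
          (num_calls r)%:R <= K * sample_bound a alpha delta m &
          (num_iterations r)%:R <= K * sample_bound a alpha delta m].
Proof.
pose c : R := ln 2 / 2.
have c0 : 0 < c by rewrite divr_gt0// ln_gt0// ltr1n.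
(* The factor [1 + k / c] turns [u + k] into a multiple of [u]. The factor [b.+1] covers the calls
   and, being at least 1, also the other two counts. *)
exists (b.+1%:R * (1 + k%:R / c)) => m a alpha delta r m1 ha halpha hdelta hr unif.
have cu := sample_bound_ge m1 ha halpha hdelta; rewrite -/c in cu.
set u := sample_bound _ _ _ _ in cu hr *.
have u0 : 0 <= u by exact: le_trans (ltW c0) cu.
suff le_K n : (n <= b.+1 * (size r * k))%N ->
    n%:R <= b.+1%:R * (1 + k%:R / c) * u.
  split; apply: le_K.
  - by rewrite (num_samples_uniform unif) leq_pmull.
  - apply: leq_trans (num_calls_le (run_calls hr)) _.
    by rewrite mulnC leq_mul// leq_pmulr.
  - by rewrite (leq_trans (leq_pmulr _ hk))// leq_pmull.
rewrite -(ler_nat R) natrM => /le_trans; apply.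
rewrite -mulrA ler_wpM2l//; apply: le_trans (uniform_run_size_le u0 hr unif) _.
(* What remains is [k <= (k / c) * u], which follows from [c <= u]. *)
rewrite mulrDl mul1r lerD2l -mulrA ler_peMr//.
by rewrite mulrC ler_pdivlMr// mul1r.
Qed.
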